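(* $\mathrm{var}(Y_k)=\Theta(k^3)$ as $k\to\infty$.
   Context: For $k\ge 1$, let $\{T_{i,j}: 1\le i\le k,\ 1\le j\le k-i+1\}$ be mutually independent random variables, where $T_{i,j}$ is geometric on $\{1,2,\ldots\}$ with success parameter $\frac{k-i-j+2}{k}$ (so $T_{i,j}$ is the waiting time, with letters drawn independently and uniformly from $[k]$, until a letter from a prescribed set of $k-i-j+2$ letters appears). Define $Y_k=\sum_{i=1}^k\sum_{j=1}^{k-i+1}T_{i,j}$. (In the paper $Y_k$ is the waiting time, in a sequence of i.i.d. uniform letters from $[k]$, to form $k$ consecutive blocks, the $i$-th block consisting of $k-i+1$ distinct prescribed letters collected in any order.) *)

(* Defs.v *)
From HB Require Import structures.
From mathcomp Require Export all_boot all_order all_algebra finmap.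
From mathcomp Require Export all_classical all_reals all_analysis.

Set Implicit Arguments.
Unset Strict Implicit.
Unset Printing Implicit Defensive.

Import Order.TTheory GRing.Theory Num.Theory.
Import numFieldNormedType.Exports.

Local Open Scope classical_set_scope.
Local Open Scope ring_scope.

(* The product rule is required for every finite subfamily and all Borel sets,
   and not only for pairs of indices. *)
Definition mutually_independent (d : measure_display) (T : measurableType d)
    (R : realType) (P : probability T R) (I : choiceType) (A : set I)
    (X : I -> T -> R) : Prop :=
  forall (J : {fset I}) (B : I -> set R),
    [set` J] `<=` A ->
    (forall a, a \in J -> measurable (B a)) ->
    P (\bigcap_(a in [set` J]) (X a @^-1` B a)) =
    (\prod_(a <- J) P (X a @^-1` B a))%E.

(* For 0 < p <= 1 these point masses sum to 1, so they determine the law.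
   When p = 1 the convention 0 ^+ 0 = 1 puts all the mass at 1. *)
Definition is_geometric (d : measure_display) (T : measurableType d)
    (R : realType) (P : probability T R) (p : R) (X : {RV P >-> R}) : Prop :=
  forall n : nat, (0 < n)%N ->
    distribution P X [set n%:R] = ((1 - p) ^+ n.-1 * p)%:E.

Definition block_index (k : nat) : set (nat * nat) :=
  [set ij | ((1 <= ij.1 <= k) && (1 <= ij.2 <= k - ij.1 + 1))%N].

Definition success_parameter (R : realType) (k i j : nat) : R :=
  (k%:R - i%:R - j%:R + 2) / k%:R.

Definition total_time (T : Type) (R : realType) (k : nat)
    (X : nat -> nat -> T -> R) : T -> R :=
  fun w => \sum_(1 <= i < k.+1) \sum_(1 <= j < (k - i + 1).+1) X i j w.

(* Main.v *)
From HB Require Import structures.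
Require Import Defs.
From mathcomp Require Import ring lra zify measurable_realfun.

Set Implicit Arguments.
Unset Strict Implicit.
Unset Printing Implicit Defensive.

Import Order.TTheory GRing.Theory Num.Theory.
Import numFieldNormedType.Exports.

Local Open Scope classical_set_scope.
Local Open Scope ring_scope.

(** A geometric variable with success parameter p has variance (1 - p) / p^2,
    and independence makes the variances add up. There are k + 1 - m index
    pairs with parameter m / k, so the variance of the total time is
    [\sum_(1 <= m <= k) (k + 1 - m) * (k - m) * k / m^2]. The terms with m = 1
    alone give k^2 (k - 1), and the convergence of [\sum 1 / m^2] bounds the
    whole sum by 2 k^3. *)

(** * Moment series of the geometric law, with explicit remainders *)

Section geometric_moment_series.
Context {R : realType}.
Variable p : R.
Hypotheses (p_gt0 : 0 < p) (p_le1 : p <= 1).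

Let p_neq0 : p != 0. Proof. by rewrite gt_eqF. Qed.
Let q_ge0 : 0 <= 1 - p. Proof. by rewrite subr_ge0. Qed.

(** By memorylessness the tail after [n] terms is [(1 - p) ^+ n] times the mean of [n + X], with [X]
    geometric; the next lemma has the mean of [(n + X)^2] instead. *)
Lemma series_geometric_mean (n : nat) :
  \sum_(0 <= i < n) i.+1%:R * ((1 - p) ^+ i * p) =
  p^-1 - (1 - p) ^+ n * (n%:R + p^-1).
Proof.
elim: n => [|n IH]; first by rewrite big_geq// mulr0n expr0; field.
rewrite big_nat_recr//= IH [_ ^+ n.+1]exprS -[n.+1%:R]natr1.
by move: (_ ^+ n) n%:R => x y; field.
Qed.

Lemma series_geometric_moment2 (n : nat) :
  \sum_(0 <= i < n) i.+1%:R ^+ 2 * ((1 - p) ^+ i * p) =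
  (2 - p) / p ^+ 2 -
  (1 - p) ^+ n * (n%:R ^+ 2 + 2 * n%:R / p + (2 - p) / p ^+ 2).
Proof.
elim: n => [|n IH]; first by rewrite big_geq// mulr0n expr0; field.
rewrite big_nat_recr//= IH [_ ^+ n.+1]exprS -[n.+1%:R]natr1.
by move: (_ ^+ n) n%:R => x y; field.
Qed.

(* The closed form bounds the partial sums, so the series converges and its
   general term vanishes; this makes the remainder in the closed form vanish. *)
Lemma cvg_sqr_geometric :
  (fun n : nat => n.+1%:R ^+ 2 * ((1 - p) ^+ n * p)) @ \oo --> 0.
Proof.
apply: cvg_series_cvg_0; apply: nondecreasing_is_cvgn.
  apply/nondecreasing_seqP => n; rewrite /series/= big_nat_recr//= lerDl.
  by rewrite !mulr_ge0 ?exprn_ge0// ltW.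
exists ((2 - p) / p ^+ 2) => _ [n _ <-].
rewrite /series/= series_geometric_moment2 gerBl mulr_ge0 ?exprn_ge0//.
have pV : 0 <= p^-1 by rewrite invr_ge0 ltW.
have p2 : 0 <= 2 - p by move: p_le1; lra.
by rewrite !addr_ge0 ?exprn_ge0 ?mulr_ge0 ?invr_ge0 ?exprn_ge0// ltW.
Qed.

(** Both remainders are [(1 - p) ^+ n] times a polynomial in [n] of degree at most two, hence
    squeezed under a multiple of the vanishing general term of the second moment series. *)
Lemma cvg_geometric_remainder (C : R) (f : nat -> R) :
  (forall n, 0 <= f n <= C * n.+1%:R ^+ 2) ->
  (fun n : nat => (1 - p) ^+ n * f n) @ \oo --> 0.
Proof.
move=> fC.
pose g (n : nat) := C / p * (n.+1%:R ^+ 2 * ((1 - p) ^+ n * p)).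
have gC : g @ \oo --> 0.
  rewrite -(mulr0 (C / p)).
  by apply: cvgM; [exact: cvg_cst|exact: cvg_sqr_geometric].
apply: (@squeeze_cvgr _ _ _ _ (cst 0) g) => //; last exact: cvg_cst.
apply: nearW => n; rewrite /g.
have /andP[f0 fCn] := fC n.
rewrite mulr_ge0 ?exprn_ge0//=.
have -> : C / p * (n.+1%:R ^+ 2 * ((1 - p) ^+ n * p)) =
  (1 - p) ^+ n * (C * n.+1%:R ^+ 2) by field.
by rewrite ler_wpM2l ?exprn_ge0.
Qed.

Lemma nneseries_geometric_mass :
  (\sum_(0 <= i <oo) ((1 - p) ^+ i * p)%:E = 1)%E.
Proof.
apply/cvg_lim => //; apply: cvg_EFin.
  by apply: nearW => n; rewrite sumEFin.
rewrite (_ : _ \o _ = (fun n => 1 - (1 - p) ^+ n)); last first.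
  apply/funext => n /=; rewrite sumEFin/=.
  elim: n => [|n IH]; first by rewrite big_geq// expr0 subrr.
  by rewrite big_nat_recr//= IH exprS; ring.
rewrite -[X in _ --> X]subr0; apply: cvgB; first exact: cvg_cst.
by apply: cvg_expr; rewrite ger0_norm//; move: p_gt0; lra.
Qed.

Lemma nneseries_geometric_mean :
  (\sum_(0 <= i <oo) (i.+1%:R * ((1 - p) ^+ i * p))%:E = (p^-1)%:E)%E.
Proof.
apply/cvg_lim => //; apply: cvg_EFin.
  by apply: nearW => n; rewrite sumEFin.
rewrite (_ : _ \o _ =
  (fun n => p^-1 - (1 - p) ^+ n * (n%:R + p^-1))); last first.
  by apply/funext => n /=; rewrite sumEFin/= series_geometric_mean.
rewrite -[X in _ --> X]subr0; apply: cvgB; first exact: cvg_cst.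
have pV : 0 <= p^-1 by rewrite invr_ge0 ltW.
apply: (@cvg_geometric_remainder (1 + p^-1)) => n.
rewrite addr_ge0//=; have := ler0n R n; rewrite -[n.+1%:R]natr1; nra.
Qed.

Lemma nneseries_geometric_moment2 :
  (\sum_(0 <= i <oo) (i.+1%:R ^+ 2 * ((1 - p) ^+ i * p))%:E =
   ((2 - p) / p ^+ 2)%:E)%E.
Proof.
apply/cvg_lim => //; apply: cvg_EFin.
  by apply: nearW => n; rewrite sumEFin.
rewrite (_ : _ \o _ = (fun n => (2 - p) / p ^+ 2 -
    (1 - p) ^+ n * (n%:R ^+ 2 + 2 * n%:R / p + (2 - p) / p ^+ 2))); last first.
  by apply/funext => n /=; rewrite sumEFin/= series_geometric_moment2.
rewrite -[X in _ --> X]subr0; apply: cvgB; first exact: cvg_cst.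
have pV : 0 <= p^-1 by rewrite invr_ge0 ltW.
have c0 : 0 <= (2 - p) / p ^+ 2.
  by rewrite mulr_ge0 ?invr_ge0 ?exprn_ge0// ?ltW//; move: p_le1; lra.
(* The constant adds the coefficients of three separate bounds by [(n + 1)^2]: of [n^2], of [2n] and
   of [1]. *)
apply: (@cvg_geometric_remainder (1 + p^-1 + (2 - p) / p ^+ 2)) => n.
move: ((2 - p) / _) c0 p^-1 pV => c c0 v v0.
have := ler0n R n; rewrite -[n.+1%:R]natr1; move: n%:R => x x0.
have [vx vx2 cx cx2] :
    [/\ 0 <= v * x, 0 <= v * (x * x), 0 <= c * x & 0 <= c * (x * x)].
  by split; rewrite ?mulr_ge0.
by apply/andP; split; nra.
Qed.

End geometric_moment_series.

Lemma sum_inv_sqr_le2 (R : realFieldType) (n : nat) :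
  \sum_(1 <= m < n.+1) (m%:R ^+ 2)^-1 <= 2 :> R.
Proof.
have [->|n_gt0] := posnP n; first by rewrite big_geq.
(* The bound [2] alone is not inductive; subtracting [1/n] lets [1/(n+1)^2 <= 1/n - 1/(n+1)]
   telescope. *)
suff : \sum_(1 <= m < n.+1) (m%:R ^+ 2)^-1 <= 2 - n%:R^-1 :> R.
  by move/le_trans; apply; rewrite gerBl invr_ge0.
elim: n n_gt0 => // -[_ _|n IH _].
  by rewrite big_nat1 expr1n invr1; lra.
rewrite big_nat_recr//=; apply: (le_trans (lerD (IH isT) (lexx _))).
have x0 : 0 < n.+1%:R :> R by rewrite ltr0n.
rewrite -[n.+2%:R]natr1; move: n.+1%:R x0 => x x0.
rewrite -subr_ge0.
have -> : 2 - (x + 1)^-1 - (2 - x^-1 + ((x + 1) ^+ 2)^-1) =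
    (x * (x + 1) ^+ 2)^-1 by field; rewrite !gt_eqF//; lra.
by rewrite invr_ge0 mulr_ge0 ?exprn_ge0//; lra.
Qed.

(** * Integration against a law carried by the positive integers *)

Section integer_valued.
Context (d : measure_display) (T : measurableType d) (R : realType).
Variables (P : probability T R) (X : {RV P >-> R}).

Lemma measurable_preimage_point (x : R) : measurable (X @^-1` [set x]).
Proof. by rewrite -[X in measurable X]setTI; exact: measurable_funP. Qed.

(** Total mass 1 means that the disjoint fibres of [X] over the positive integers cover the space up
    to a null set, and [f] composed with [X] is constant on each fibre. *)
Lemma integral_positive_integer (f : R -> R) :
  (\sum_(0 <= n <oo) distribution P X [set n.+1%:R] = 1)%E ->
  measurable_fun setT f -> (forall n : nat, 0 <= f n.+1%:R) ->
  (\int[P]_w (f (X w))%:E =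
   \sum_(0 <= n <oo) (f n.+1%:R)%:E * distribution P X [set n.+1%:R])%E.
Proof.
move=> mass1 mf f0.
pose F (n : nat) := X @^-1` [set n.+1%:R].
have mF n : measurable (F n) by exact: measurable_preimage_point.
have mU : measurable (\bigcup_n F n) by exact: bigcupT_measurable.
have tF : trivIset setT F.
  apply/trivIsetP => i j _ _ ij; rewrite -subset0 => w []; rewrite /F/=.
  by move=> -> /eqP; rewrite eqr_nat eqSS (negbTE ij).
have PU : P (\bigcup_n F n) = 1%E.
  rewrite -mass1 measure_bigcup//.
  by apply: eq_eseriesl => n; rewrite in_setT.
have PUC : P (~` \bigcup_n F n) = 0%E.
  by rewrite probability_setC// PU subee.
have mg : measurable_fun setT (fun w => (f (X w))%:E).
  by apply/measurable_EFinP; exact: measurableT_comp.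
rewrite (@ae_eq_integral _ _ _ P setT
  ((fun w => (f (X w))%:E) \_ (\bigcup_n F n)))//.
- rewrite -integral_mkcond ge0_integral_bigcup//.
  + apply: eq_eseriesr => n _.
    rewrite (eq_integral (cst (f n.+1%:R)%:E)); last first.
      by move=> w; rewrite inE /F/= => ->.
    by rewrite integral_cst.
  + exact: measurable_funS mg.
  + by move=> w [n _]; rewrite /F/= => ->; rewrite lee_fin.
- by apply/measurable_restrict => //; exact: measurable_funS mg.
- exists (~` \bigcup_n F n); split.
  + exact: measurableC.
  + exact: PUC.
  + by move=> w /=; apply: contra_not => Fw _; rewrite patchE ifT// inE.
Qed.

End integer_valued.

(** * Square integrability and variance of a geometric variable *)

Section geometric_variance.
Context (d : measure_display) (T : measurableType d) (R : realType).
Variables (P : probability T R) (X : {RV P >-> R}) (p : R).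
Hypotheses (p_gt0 : 0 < p) (p_le1 : p <= 1) (X_geom : is_geometric p X).

Let mass1 : (\sum_(0 <= n <oo) distribution P X [set n.+1%:R] = 1)%E.
Proof.
rewrite -[RHS](nneseries_geometric_mass p_gt0 p_le1).
by apply: eq_eseriesr => n _; rewrite X_geom.
Qed.

Let integral_sqr : (\int[P]_w (X w ^+ 2)%:E = ((2 - p) / p ^+ 2)%:E)%E.
Proof.
rewrite (@integral_positive_integer _ _ _ P X (fun x => x ^+ 2))//.
rewrite -[RHS](nneseries_geometric_moment2 p_gt0 p_le1).
by apply: eq_eseriesr => n _; rewrite X_geom.
Qed.

Lemma geometric_Lfun2 : (X : T -> R) \in Lfun P 2%:E.
Proof.
rewrite inE; apply/andP; split; first by rewrite inE/=.
rewrite inE/= /finite_norm unlock /Lnorm/=.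
rewrite poweR_lty//.
under eq_integral do rewrite powR_mulrn// -normrX ger0_norm ?sqr_ge0//.
by rewrite integral_sqr ltry.
Qed.

Lemma geometric_variance : ('V_P[X] = ((1 - p) / p ^+ 2)%:E)%E.
Proof.
rewrite varianceE ?geometric_Lfun2//.
have -> : ('E_P[X] = (p^-1)%:E)%E.
  rewrite unlock (@integral_positive_integer _ _ _ P X id)//.
  rewrite -[RHS](nneseries_geometric_mean p_gt0 p_le1).
  by apply: eq_eseriesr => n _; rewrite X_geom.
have -> : ('E_P[(X : T -> R) ^+ 2] = ((2 - p) / p ^+ 2)%:E)%E.
  by rewrite unlock; exact: integral_sqr.
by rewrite -EFin_expe -EFinB; congr EFin; field; rewrite gt_eqF.
Qed.

End geometric_variance.

(** * Expectation of a product of two independent variables *)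

Section independent_expectation.
Context (d : measure_display) (T : measurableType d) (R : realType).
Variable P : probability T R.
Variables X Y : {RV P >-> R}.
Hypothesis XY_indep : forall A B : set R, measurable A -> measurable B ->
  P (X @^-1` A `&` Y @^-1` B) = (P (X @^-1` A) * P (Y @^-1` B))%E.

(** Independence makes the joint law of [(X, Y)] the product of the two laws, and Fubini then
    factors the integral of [x * y]. *)
Lemma expectationM_independent :
  (X : T -> R) \in Lfun P 2%:E -> (Y : T -> R) \in Lfun P 2%:E ->
  ('E_P[(X : T -> R) * (Y : T -> R)] = 'E_P[X] * 'E_P[Y])%E.
Proof.
move=> X2 Y2.
have Pfin : P setT \is a fin_num := fin_num_measure P _ measurableT.
have /Lfun1_integrable X1 := Lfun_subset12 Pfin X2.
have /Lfun1_integrable Y1 := Lfun_subset12 Pfin Y2.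
have /Lfun1_integrable XY1 := Lfun2_mul_Lfun1 X2 Y2.
have mXY : measurable_fun setT (fun w => (X w, Y w)).
  by apply/measurable_fun_pairP; split; exact: measurable_funP.
pose Z : {RV P >-> (R * R)%type} := HB.pack (fun w => (X w, Y w))
  (isMeasurableFun.Build _ _ _ _ _ mXY).
pose f (z : R * R) := (z.1 * z.2)%:E.
have mf : measurable_fun setT f.
  by apply/measurable_EFinP; apply: measurable_funM.
(* A measure that agrees with the product on measurable rectangles is the product measure; the
   rectangles are exactly [XY_indep]. *)
have prodE A : measurable A ->
    (distribution P X \x distribution P Y)%E A = distribution P Z A.
  by apply: product_measure_unique => B C mB mC; rewrite -XY_indep.
have fZ : P.-integrable setT (f \o Z) by [].
(* Fubini needs integrability under the product law; it is carried over from that of [X * Y] under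
   [P] through the joint law. *)
have f_int : (distribution P X \x distribution P Y)%E.-integrable setT f.
  apply/integrableP; split=> //.
  rewrite (eq_measure_integral (distribution P Z)); last first.
    by move=> A mA _; exact: prodE.
  by have /integrableP[] := integrable_pushforward mXY mf fZ measurableT.
transitivity (\int[distribution P Z]_z f z)%E.
  by rewrite unlock integral_distribution.
rewrite (eq_measure_integral (distribution P X \x distribution P Y)%E);
  last first.
  by move=> A mA _; rewrite [RHS]prodE.
rewrite -integral12_prod_meas1//.
have EX : (\int[distribution P X]_x x%:E = 'E_P[X])%E.
  by rewrite unlock integral_distribution.
have EY : (\int[distribution P Y]_y y%:E = 'E_P[Y])%E.
  by rewrite unlock integral_distribution.
have iX : (distribution P X).-integrable setT (fun x => x%:E).
  apply: integrable_pushforward; rewrite ?preimage_setT//.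
  exact/measurable_EFinP.
have iY : (distribution P Y).-integrable setT (fun y => y%:E).
  apply: integrable_pushforward; rewrite ?preimage_setT//.
  exact/measurable_EFinP.
have EYfin : 'E_P[Y]%E \is a fin_num.
  by rewrite expectation_fin_num//; exact/Lfun1_integrable.
rewrite -EX -(fineK EYfin) -integralZr//.
by apply: eq_integral => x _; rewrite /fubini_F fineK// -EY -integralZl.
Qed.
End independent_expectation.

(** * Variance of a finite sum of uncorrelated variables *)

Section variance_sum.
Context (d : measure_display) (T : measurableType d) (R : realType).
Variable P : probability T R.

Lemma Lfun2_sum (I : eqType) (s : seq I) (X : I -> T -> R) :
  {in s, forall i, X i \in Lfun P 2%:E} -> \sum_(i <- s) X i \in Lfun P 2%:E.
Proof.
move=> X2; rewrite big_seq; apply: rpred_sum => [|? i si]; last exact: X2.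
by rewrite lee_fin ler1n.
Qed.

Lemma covariance_sumr (I : eqType) (s : seq I) (X : T -> R) (Y : I -> T -> R) :
  X \in Lfun P 2%:E -> {in s, forall i, Y i \in Lfun P 2%:E} ->
  covariance P X (\sum_(i <- s) Y i) = (\sum_(i <- s) covariance P X (Y i))%E.
Proof.
move=> X2; elim: s => [|i s IH] Y2; first by rewrite !big_nil covariance_cst_r.
have Ys : {in s, forall j, Y j \in Lfun P 2%:E}.
  by move=> j js; rewrite Y2// inE js orbT.
rewrite !big_cons -IH//; apply: covarianceDr => //; first by rewrite Y2 ?mem_head.
exact: Lfun2_sum.
Qed.

Lemma variance_sum_uncorrelated (I : eqType) (s : seq I) (X : I -> T -> R) :
  uniq s -> {in s, forall i, X i \in Lfun P 2%:E} ->
  {in s &, forall i j, i != j -> covariance P (X i) (X j) = 0%E} ->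
  ('V_P[(\sum_(i <- s) X i)%R] = \sum_(i <- s) 'V_P[X i])%E.
Proof.
elim: s => [|i s IH]; first by rewrite !big_nil variance_cst.
move=> /=/andP[i_s us] X2 X0; rewrite !big_cons.
have Xs : {in s, forall j, X j \in Lfun P 2%:E}.
  by move=> j js; rewrite X2// inE js orbT.
have Xi : X i \in Lfun P 2%:E by rewrite X2 ?mem_head.
rewrite [LHS]varianceD//; last exact: Lfun2_sum.
have -> : covariance P (X i) (\sum_(j <- s) X j) = 0%E.
  rewrite covariance_sumr// big_seq big1// => j js.
  apply: X0; rewrite ?mem_head// ?inE ?js ?orbT//.
  (* The absence of duplicates separates the head [i] from every [j] in the tail. *)
  by apply: contraNneq i_s => ->.
rewrite mule0 adde0 IH// => j k js ks.
by apply: X0; rewrite inE ?js ?ks orbT.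
Qed.

End variance_sum.

(** This is the product rule for the subfamily [[fset a; b]], which has two elements because
    [a != b]. *)
Lemma mutually_independent_pair (d : measure_display) (T : measurableType d)
    (R : realType) (P : probability T R) (I : choiceType) (A : set I)
    (X : I -> T -> R) (a b : I) (B C : set R) :
  mutually_independent P A X -> A a -> A b -> a != b ->
  measurable B -> measurable C ->
  (P (X a @^-1` B `&` X b @^-1` C) = P (X a @^-1` B) * P (X b @^-1` C))%E.
Proof.
move=> indep Aa Ab ab mB mC.
have ba : b == a = false by rewrite eq_sym (negbTE ab).
pose D i := if i == a then B else C.
have := indep [fset a; b]%fset D.
rewrite big_fsetU1/= ?inE// big_seq_fset1 /D eqxx ba => <-.
- congr (P _); apply/seteqP; split => [w [Ba Cb] i /=|w Dw].
    by rewrite !inE => /orP[]/eqP ->; rewrite ?eqxx ?ba.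
  by split; [have := Dw a|have := Dw b]; rewrite /= !inE !eqxx ?orbT ?ba; apply.
- by move=> i /=; rewrite !inE => /orP[]/eqP ->.
- by move=> i _; case: ifP.
Qed.

(** * Exact variance of the total time *)

Section total_time_variance.
Context (d : measure_display) (T : measurableType d) (R : realType).
Variables (P : probability T R) (k : nat) (X : nat -> nat -> {RV P >-> R}).
Hypotheses (X_indep : mutually_independent P (block_index k)
    (fun ij : nat * nat => X ij.1 ij.2))
  (X_geom : forall i j, block_index k (i, j) ->
    is_geometric (success_parameter R k i j) (X i j)).

(** The numerator is at least 1 because [i + j <= k + 1], and at most [k] because [i] and [j] are at
    least 1. *)
Lemma success_parameter_bounds (i j : nat) : block_index k (i, j) ->
  0 < success_parameter R k i j <= 1.
Proof.
rewrite /block_index/= => /andP[/andP[i1 ik] /andP[j1 jk]].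
have k0 : 0 < k%:R :> R by rewrite ltr0n (leq_trans i1).
have ijk : (i + j <= k + 1)%N by lia.
have ijR : i%:R + j%:R <= k%:R + 1 :> R by rewrite -natrD natr1 -addn1 ler_nat.
have i1R : 1 <= i%:R :> R by rewrite ler1n.
have j1R : 1 <= j%:R :> R by rewrite ler1n.
rewrite /success_parameter divr_gt0//=; last by lra.
by rewrite ler_pdivrMr// mul1r; lra.
Qed.

Lemma total_time_variance :
  'V_P[total_time k (fun i j => X i j)] =
  (\sum_(1 <= i < k.+1) \sum_(1 <= j < (k - i + 1).+1)
    (1 - success_parameter R k i j) / success_parameter R k i j ^+ 2)%:E.
Proof.
(* Flattening the double sum over a duplicate-free list of pairs reduces it to
   [variance_sum_uncorrelated]. *)
pose s := [seq (i, j) | i <- index_iota 1 k.+1,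
                        j <- index_iota 1 (k - i + 1).+1].
have sP ij : ij \in s -> block_index k ij.
  move=> /allpairsPdep[i [j [+ + ->]]]; rewrite !mem_index_iota /block_index/=.
  by rewrite !ltnS => -> ->.
have us : uniq s.
  apply: allpairs_uniq_dep => [|i _|]; rewrite ?iota_uniq//.
  by move=> [i j] [i' j'] _ _ [-> ->].
have -> : total_time k (fun i j => X i j) =
    \sum_(ij <- s) (X ij.1 ij.2 : T -> R).
  by apply/funext => w; rewrite /total_time fct_sumE big_allpairs_dep.
have X2 : {in s, forall ij, (X ij.1 ij.2 : T -> R) \in Lfun P 2%:E}.
  move=> [i j] /sP ij; have /andP[p0 p1] := success_parameter_bounds ij.
  exact: geometric_Lfun2 p0 p1 (X_geom ij).
rewrite variance_sum_uncorrelated//.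
  rewrite (eq_big_seq (fun ij : nat * nat =>
    ((1 - success_parameter R k ij.1 ij.2) /
      success_parameter R k ij.1 ij.2 ^+ 2)%:E))/=.
    by rewrite sumEFin big_allpairs_dep.
  move=> [i j] /sP ij; have /andP[p0 p1] := success_parameter_bounds ij.
  exact: geometric_variance p0 p1 (X_geom ij).
move=> a b sa sb ab.
have a2 := X2 _ sa; have b2 := X2 _ sb.
have Pfin : P setT \is a fin_num := fin_num_measure P _ measurableT.
have a1 := Lfun_subset12 Pfin a2; have b1 := Lfun_subset12 Pfin b2.
rewrite covarianceE//; last exact: Lfun2_mul_Lfun1.
rewrite expectationM_independent// ?subee//.
  by rewrite fin_numM// expectation_fin_num.
move=> B C mB mC.
exact: (mutually_independent_pair X_indep (sP _ sa) (sP _ sb)).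
Qed.

End total_time_variance.

(** * Cubic lower and upper bounds for the variance sum *)

Section variance_bounds.
Context (R : realType) (k : nat).
Hypothesis k_gt1 : (1 < k)%N.
Let v (i j : nat) : R :=
  (1 - success_parameter R k i j) / success_parameter R k i j ^+ 2.

Let k_gt0 : 0 < k%:R :> R. Proof. by rewrite ltr0n ltnW. Qed.

Let v_ge0 i j : block_index k (i, j) -> 0 <= v i j.
Proof.
move=> /(success_parameter_bounds R)/andP[p0 p1].
by rewrite /v divr_ge0 ?exprn_ge0 ?subr_ge0// ltW.
Qed.

(* Only the last collection step of each block, with success parameter 1/k, is
   kept: it already contributes k(k-1). *)
Lemma total_variance_ge :
  k%:R ^+ 3 / 2 <= \sum_(1 <= i < k.+1) \sum_(1 <= j < (k - i + 1).+1) v i j.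
Proof.
have -> : k%:R ^+ 3 / 2 = \sum_(1 <= i < k.+1) (k%:R ^+ 2 / 2) :> R.
  by rewrite big_const_nat subn1/= iter_addr_0 -mulr_natr; field.
rewrite big_nat_cond [leRHS]big_nat_cond; apply: ler_sum => i.
rewrite andbT ltnS => /andP[i1 ik].
rewrite big_nat_recr/=; last by rewrite addn1.
have last_v : v i (k - i + 1) = k%:R * (k%:R - 1).
  rewrite /v /success_parameter natrD natrB//.
  have -> : k%:R - i%:R - (k%:R - i%:R + 1) + 2 = 1 :> R by ring.
  by field; rewrite gt_eqF.
(* From [k >= 2] follows [k * (k - 1) >= k^2 / 2], the share of [k^3 / 2] allotted to each of the
   [k] blocks. *)
have k2 : 2 <= k%:R :> R by rewrite ler_nat.
rewrite -[leLHS]add0r lerD//; last by rewrite last_v; nra.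
rewrite big_nat_cond sumr_ge0// => j; rewrite andbT => /andP[j1 jk].
by apply: v_ge0; rewrite /block_index/= i1 ik j1 ltnW.
Qed.

(** Each block contributes at most [k^2] times a partial sum of the inverse squares, hence at most
    [2 * k^2], and there are [k] blocks. *)
Lemma total_variance_le :
  \sum_(1 <= i < k.+1) \sum_(1 <= j < (k - i + 1).+1) v i j <= 2 * k%:R ^+ 3.
Proof.
have -> : 2 * k%:R ^+ 3 = \sum_(1 <= i < k.+1) (2 * k%:R ^+ 2) :> R.
  by rewrite big_const_nat subn1/= iter_addr_0 -mulr_natr; ring.
rewrite big_nat_cond [leRHS]big_nat_cond; apply: ler_sum => i.
rewrite andbT ltnS => /andP[i1 ik].
apply: (@le_trans _ _
    (k%:R ^+ 2 * \sum_(1 <= m < (k - i + 1).+1) (m%:R ^+ 2)^-1)); last first.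
  by rewrite mulrC ler_wpM2r ?exprn_ge0 ?sum_inv_sqr_le2.
(* Reversing the block replaces [j] by [k - i + 2 - j], so that the success parameter becomes
   [j / k] and the term [k^2 / j^2 - k / j]. *)
rewrite big_nat_rev/= mulr_sumr big_nat_cond [leRHS]big_nat_cond.
apply: ler_sum => j; rewrite andbT ltnS => /andP[j1 jk].
have -> : (1 + (k - i + 1).+1 - j.+1 = k - i + 2 - j)%N by lia.
have j0 : 0 < j%:R :> R by rewrite ltr0n.
rewrite /v /success_parameter natrB; last by lia.
rewrite natrD natrB//.
have -> : k%:R - i%:R - (k%:R - i%:R + 2 - j%:R) + 2 = j%:R :> R by ring.
have -> : (1 - j%:R / k%:R) / (j%:R / k%:R) ^+ 2 =
  k%:R ^+ 2 / j%:R ^+ 2 - k%:R / j%:R :> R by field; rewrite !gt_eqF.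
by rewrite gerBl divr_ge0// ltW.
Qed.

End variance_bounds.

(* 'V_P is extended-real valued. As [fine] sends infinities to 0, the lower
   bound in Theta forces the variance to be finite for all large k. *)
Theorem theorem4 (R : realType) (d : nat -> measure_display)
    (Omega : forall k : nat, measurableType (d k))
    (P : forall k : nat, probability (Omega k) R)
    (X : forall k : nat, nat -> nat -> {RV (P k) >-> R})
    (X_indep : forall k : nat, (1 <= k)%N ->
      mutually_independent (P k) (block_index k)
        (fun ij : nat * nat => X k ij.1 ij.2))
    (X_geom : forall k i j : nat, (1 <= k)%N -> block_index k (i, j) ->
      is_geometric (success_parameter R k i j) (X k i j)) :
  (fun k : nat => fine ('V_(P k)[total_time k (fun i j => X k i j)]) : R^o)
    =Theta_\oo (fun k : nat => k%:R ^+ 3 : R^o).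
Proof.
(* The two constants are those of [total_variance_ge] and [total_variance_le], both valid once
   [k > 1]. *)
rewrite eqThetaE qualifE; apply/asboolP; exists (2^-1, 2) => /=.
  by rewrite invr_gt0 !ltr0n.
near=> k.
have k1 : (1 < k)%N by near: k; exact: nbhs_infty_gt.
rewrite (@total_time_variance _ _ _ _ k); last 2 first.
- exact/X_indep/ltnW.
- by move=> i j; apply/X_geom/ltnW.
have lo := total_variance_ge R k1; have hi := total_variance_le R k1.
have k3 : 0 <= k%:R ^+ 3 :> R by rewrite exprn_ge0.
rewrite /= (ger0_norm k3) ger0_norm; last by apply: le_trans lo; rewrite divr_ge0.
by rewrite mulrC.
Unshelve. all: by end_near. Qed.
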